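(* Consider the finite complete-information game with pure-strategy Nash equilibrium described in the context, with players $i=1,\ldots,I$, finite action sets $\mathcal Y_i$, payoffs $$u_i^{(\gamma,\sigma)}(y,x,\lambda,\varepsilon_i)=v_i^\gamma(y,x)+r_i(y_i)^\top S_i(\sigma)\lambda+r_i(y_i)^\top\varepsilon_i,$$ where $v_i^\gamma(y,x)$ is affine in $\gamma$ for each $i,y,x$. Suppose that $\lambda,\varepsilon_1,\ldots,\varepsilon_I$ are mutually independent and independent of $x$, that $\lambda$ has a log-concave density $h$, that each $\varepsilon_i$ has a log-concave density $q_i$, and that none of these densities depends on $\theta=(\gamma,\sigma)$. Then, for each fixed $\sigma\in\Sigma$, each $y\in\mathcal Y$ and each $x\in\mathcal X$, for all $\gamma$ and $\lambda$, $$\mathcal L_{(\gamma,\sigma)}(y\mid x,\lambda)=\prod_{i=1}^I\mathcal M_i^{(\gamma,\sigma)}(y_i\mid y_{-i},x,\lambda),$$ and $$\mathcal L_{(\gamma,\sigma)}(y\mid x)=\int\prod_{i=1}^I\mathcal M_i^{(\gamma,\sigma)}(y_i\mid y_{-i},x,\lambda)\,h(\lambda)\,d\lambda.$$ Moreover, for each fixed $\sigma$, $y$, $x$: for every $i$, $\mathcal M_i^{(\gamma,\sigma)}(y_i\mid y_{-i},x,\lambda)$ is log-concave in $(\gamma,\lambda)$; $\mathcal L_{(\gamma,\sigma)}(y\mid x,\lambda)$ is log-concave in $(\gamma,\lambda)$; and $\mathcal L_{(\gamma,\sigma)}(y\mid x)$ is log-concave in $\gamma$.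
   Context: Game. Players are $i\in\{1,\ldots,I\}$; player $i$ has a finite action set $\mathcal Y_i$, and $\mathcal Y=\mathcal Y_1\times\cdots\times\mathcal Y_I$. A profile is written $y=(y_i,y_{-i})$. The covariate $x$ takes values in a discrete set $\mathcal X$. The parameter is $\theta=(\gamma,\sigma)$ with $\gamma\in\Gamma\subseteq\mathbb R^k$ and $\sigma\in\Sigma$. The unobservables are a common shock $\lambda\in\mathbb R^d$ with Lebesgue density $h$ and player-specific shocks $\varepsilon_i\in\mathbb R^{d_i}$ with Lebesgue densities $q_i$; write $\varepsilon=(\varepsilon_1,\ldots,\varepsilon_I)$, with joint density $\prod_i q_i(\varepsilon_i)$. Here $r_i(y_i)\in\mathbb R^{d_i}$ is a known vector for each $y_i\in\mathcal Y_i$, $S_i(\sigma)$ is a $d_i\times d$ matrix depending only on $\sigma$, and ''$v_i^\gamma(y,x)$ is affine in $\gamma$'' means that $\gamma\mapsto v_i^\gamma(y,x)$ is the restriction to $\Gamma$ of an affine function on $\mathbb R^k$. Equilibrium. $G_{(\gamma,\sigma)}(x,\lambda,\varepsilon)$ is the set of pure-strategy Nash equilibria: the set of $y\in\mathcal Y$ such that $u_i^{(\gamma,\sigma)}(y_i,y_{-i},x,\lambda,\varepsilon_i)\ge u_i^{(\gamma,\sigma)}(a_i,y_{-i},x,\lambda,\varepsilon_i)$ for all $a_i\in\mathcal Y_i$ and all $i$. Probabilities. Define $$D_{i,a_i}^{(\gamma,\sigma)}(y,x,\lambda,\varepsilon_i)=u_i^{(\gamma,\sigma)}(y_i,y_{-i},x,\lambda,\varepsilon_i)-u_i^{(\gamma,\sigma)}(a_i,y_{-i},x,\lambda,\varepsilon_i).$$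 The player-level best-response probability is $$\mathcal M_i^{(\gamma,\sigma)}(y_i\mid y_{-i},x,\lambda)=\Pr_{\varepsilon_i}\big(D_{i,a_i}^{(\gamma,\sigma)}(y,x,\lambda,\varepsilon_i)\ge0\ \text{for all } a_i\in\mathcal Y_i\mid x,\lambda\big).$$ The singleton-event generalized likelihoods are $$\mathcal L_{(\gamma,\sigma)}(y\mid x,\lambda)=\Pr_{\varepsilon}\big(y\in G_{(\gamma,\sigma)}(x,\lambda,\varepsilon)\mid x,\lambda\big),\qquad \mathcal L_{(\gamma,\sigma)}(y\mid x)=\Pr_{\varepsilon,\lambda}\big(y\in G_{(\gamma,\sigma)}(x,\lambda,\varepsilon)\mid x\big).$$ By independence, the conditional probabilities are computed with $x$ (and $\lambda$, where it is conditioned on) held fixed, under the unconditional law of the remaining shocks. Log-concavity. A nonnegative function $f$ on a subset $C$ of a Euclidean space is log-concave if $f((1-t)a+tb)\ge f(a)^{1-t}f(b)^t$ for all $t\in(0,1)$ and all $a,b\in C$ with $(1-t)a+tb\in C$ (zeros are allowed). Functions of $\gamma$ are considered on $\Gamma$ and functions of $(\gamma,\lambda)$ on $\Gamma\times\mathbb R^d$. *)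

(* Defs.v *)
From HB Require Import structures.
From mathcomp Require Import all_boot all_order all_algebra.
From mathcomp Require Import all_classical all_reals all_analysis.

Set Implicit Arguments.
Unset Strict Implicit.
Unset Printing Implicit Defensive.
Import Order.TTheory GRing.Theory Num.Theory.
Import numFieldNormedType.Exports.

Local Open Scope classical_set_scope.
Local Open Scope ring_scope.

(* Vectors of R^n are column matrices 'cV[R]_n.  Matrices carry the product
   sigma-algebra, i.e. the one generated by the entries (for R^n this is the
   Borel sigma-algebra). *)

Definition measure_matrix_display : measure_display -> measure_display.
Proof. exact. Qed.

Definition measurable_mx d (T : measurableType d) (m n : nat) :
    set (set 'M[T]_(m, n)) :=
  <<s \bigcup_(ij in [set: 'I_m * 'I_n])
        preimage_set_system setT (fun M : 'M[T]_(m, n) => M ij.1 ij.2)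
          measurable >>.

Section measurable_matrix.
Context {d} {T : measurableType d} {m n : nat}.

Let mx_set0 : measurable_mx (set0 : set 'M[T]_(m, n)).
Proof. exact: sigma_algebra0. Qed.

Let mx_setC (A : set 'M[T]_(m, n)) :
  measurable_mx A -> measurable_mx (~` A).
Proof. exact: sigma_algebraC. Qed.

Let mx_bigcup (F : (set 'M[T]_(m, n))^nat) :
  (forall i, measurable_mx (F i)) -> measurable_mx (\bigcup_i (F i)).
Proof. exact: sigma_algebra_bigcup. Qed.

HB.instance Definition _ := @isMeasurable.Build (measure_matrix_display d)
  'M[T]_(m, n) (@measurable_mx d T m n) mx_set0 mx_setC mx_bigcup.

End measurable_matrix.

Lemma measurable_fun_coord d (T : measurableType d) m n (i : 'I_m) (j : 'I_n) :
  measurable_fun [set: 'M[T]_(m, n)] (fun M : 'M[T]_(m, n) => M i j).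
Proof.
move=> _ B mB; apply: sub_sigma_algebra.
by exists (i, j) => //; exists B.
Qed.

Lemma measurable_fun_mx d d' (S : measurableType d') (T : measurableType d)
    m n (f : S -> 'M[T]_(m, n)) :
  (forall i j, measurable_fun setT (fun s => f s i j)) ->
  measurable_fun setT f.
Proof.
move=> mf; apply: (@measurability _ _ _ _ _ _
  (\bigcup_(ij in [set: 'I_m * 'I_n])
    preimage_set_system setT (fun M : 'M[T]_(m, n) => M ij.1 ij.2)
      measurable)) => //.
move=> _ [_ [[i j] _ [B mB <-]] <-].
rewrite !setTI; have := mf i j measurableT B mB; by rewrite setTI.
Qed.

(* Not derivable by sigma_finiteT: the sigma-finite instance of m1 \x m2 is
   shadowed by the one for subprobabilities. *)
Lemma sigma_finite_product d1 d2 (T1 : measurableType d1)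
    (T2 : measurableType d2) (R : realType)
    (m1 : {sigma_finite_measure set T1 -> \bar R})
    (m2 : {sigma_finite_measure set T2 -> \bar R}) :
  sigma_finite setT (m1 \x m2)%E.
Proof.
have /sigma_finiteP[F [TF ndF Foo]] := sigma_finiteT m1.
have /sigma_finiteP[G [TG ndG Goo]] := sigma_finiteT m2.
exists (fun k => F k `*` G k).
  rewrite -setXTT TF TG predeqE => -[x y]; split.
    move=> [/= [i _ Fix] [j _ Gjy]]; exists (maxn i j) => //; split.
    - by move: x Fix; exact/subsetPset/ndF/leq_maxl.
    - by move: y Gjy; exact/subsetPset/ndG/leq_maxr.
  by move=> [k _ []/= ? ?]; split; exists k.
move=> k; have [? ?] := Foo k; have [? ?] := Goo k.
split; first exact: measurableX.
by rewrite product_measure1E// lte_mul_pinfty// ge0_fin_numE.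
Qed.

Section lebesgue_cV.
Context {R : realType}.

Definition cons_cV n (p : measurableTypeR R * 'cV[R]_n) : 'cV[R]_n.+1 :=
  col_mx (const_mx p.1 : 'cV[R]_1) p.2.

Definition uncons_cV n (v : 'cV[R]_n.+1) : measurableTypeR R * 'cV[R]_n :=
  (v ord0 ord0, dsubmx (v : 'cV[R]_(1 + n))).

Lemma cons_cV0 n (p : measurableTypeR R * 'cV[R]_n) :
  cons_cV p ord0 ord0 = p.1.
Proof.
have -> : (ord0 : 'I_n.+1) = lshift n (ord0 : 'I_1) by apply/val_inj.
exact: etrans (col_mxEu _ _ _ _) (mxE _ _ _ _).
Qed.

Lemma cons_cVS n (p : measurableTypeR R * 'cV[R]_n) (i : 'I_n) :
  cons_cV p (lift ord0 i) ord0 = p.2 i ord0.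
Proof.
have -> : lift ord0 i = rshift 1 i by apply/val_inj.
exact: col_mxEd.
Qed.

Lemma cons_cVK n : cancel (@cons_cV n) (@uncons_cV n).
Proof.
move=> p; rewrite /uncons_cV cons_cV0 /cons_cV col_mxKd.
by case: p.
Qed.

Lemma measurable_cons_cV n : measurable_fun setT (@cons_cV n).
Proof.
apply: measurable_fun_mx => i j; rewrite /cons_cV.
have [k ->|k ->] := @split_ordP 1 n i.
  have -> : (fun s : measurableTypeR R * 'cV[R]_n =>
      (col_mx (const_mx s.1 : 'cV[R]_1) s.2 : 'cV[R]_(1 + n))
        (lshift n k) j) = fst.
    by apply/funext => p; rewrite col_mxEu mxE.
  exact: measurable_fst.
have -> : (fun s : measurableTypeR R * 'cV[R]_n =>
    (col_mx (const_mx s.1 : 'cV[R]_1) s.2 : 'cV[R]_(1 + n))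
      (rshift 1 k) j) = (fun v : 'cV[R]_n => v k j) \o snd.
  by apply/funext => p; rewrite col_mxEd.
exact: (measurableT_comp (measurable_fun_coord _ _) measurable_snd).
Qed.

Lemma measurable_uncons_cV n : measurable_fun setT (@uncons_cV n).
Proof.
apply: measurable_fun_pair; first exact: measurable_fun_coord.
apply: measurable_fun_mx => i j.
under eq_fun do rewrite mxE; exact: measurable_fun_coord.
Qed.

Definition lebesgue_cons n (mu : {sigma_finite_measure set 'cV[R]_n -> \bar R}) :
    set 'cV[R]_n.+1 -> \bar R :=
  pushforward (lebesgue_measure \x mu)%E (@cons_cV n).

Section lebesgue_cons.
Context {n : nat} (mu : {sigma_finite_measure set 'cV[R]_n -> \bar R}).

Let pre (A : set 'cV[R]_n.+1) :
  measurable A -> measurable (@cons_cV n @^-1` A).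
Proof.
by move=> mA; rewrite -[X in measurable X]setTI; exact: measurable_cons_cV.
Qed.

Let lebesgue_cons0 : lebesgue_cons mu set0 = 0%E.
Proof. by rewrite /lebesgue_cons /pushforward preimage_set0 measure0. Qed.

Let lebesgue_cons_ge0 A : (0 <= lebesgue_cons mu A)%E.
Proof. rewrite /lebesgue_cons /pushforward; exact: measure_ge0. Qed.

Let lebesgue_cons_sigma_additive : semi_sigma_additive (lebesgue_cons mu).
Proof.
move=> F mF tF mUF; rewrite /lebesgue_cons /pushforward preimage_bigcup.
apply: measure_semi_sigma_additive.
- by move=> i; exact: pre.
- apply/trivIsetP => i j _ _ ij; rewrite -preimage_setI.
  by move/trivIsetP : tF => /(_ _ _ _ _ ij) ->//; rewrite preimage_set0.
- by rewrite -preimage_bigcup; exact: pre.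
Qed.

HB.instance Definition _ := isMeasure.Build _ _ _ (lebesgue_cons mu)
  lebesgue_cons0 lebesgue_cons_ge0 lebesgue_cons_sigma_additive.

Let lebesgue_cons_sigma_finite : sigma_finite setT (lebesgue_cons mu).
Proof.
have [F FT Foo] := sigma_finite_product (@lebesgue_measure R) mu.
have K k : @cons_cV n @^-1` (@uncons_cV n @^-1` F k) = F k.
  by rewrite -comp_preimage; apply/seteqP; split=> p /=; rewrite cons_cVK.
exists (fun k => @uncons_cV n @^-1` F k).
  by rewrite -preimage_bigcup -FT preimage_setT.
move=> k; have [mF Fk] := Foo k; split.
  rewrite -[X in measurable X]setTI; exact: measurable_uncons_cV.
by rewrite /lebesgue_cons /pushforward K.
Qed.

HB.instance Definition _ := Measure_isSigmaFinite.Build _ _ _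
  (lebesgue_cons mu) lebesgue_cons_sigma_finite.

End lebesgue_cons.

(* Lebesgue measure on R^n as an iterated product; on R^0 it is the unit mass
   at the only point. *)
Fixpoint lebesgue_cV (n : nat) : {sigma_finite_measure set 'cV[R]_n -> \bar R} :=
  match n with
  | 0 => \d_(0 : 'cV[R]_0)
  | n'.+1 => lebesgue_cons (lebesgue_cV n')
  end.

Lemma lebesgue_cV_box n (A : 'I_n -> set (measurableTypeR R)) :
  (forall i, measurable (A i)) ->
  lebesgue_cV n [set v : 'cV[R]_n | forall i, A i (v i 0)] =
  (\prod_(i < n) lebesgue_measure (A i))%E.
Proof.
elim: n A => [|n IH] A mA.
  by rewrite big_ord0 /= diracE mem_set// => -[].
rewrite big_ord_recl -IH; last by move=> i; exact: mA.
rewrite /= /lebesgue_cons /pushforward -product_measure1E//; last first.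
  rewrite (_ : [set _ | _] = \bigcap_(i in [set: 'I_n])
      ((fun v : 'cV[R]_n => v i 0) @^-1` A (lift ord0 i))); last first.
    by apply/seteqP; split=> v /= H i; [move=> _|]; exact: H.
  apply: fin_bigcap_measurable => // i _.
  rewrite -[X in measurable X]setTI.
  exact: (measurable_fun_coord i 0 measurableT (mA _)).
congr (_ _); apply/seteqP; split=> -[x v] /=.
  move=> H; split; first by move: (H ord0); rewrite (cons_cV0 (x, v)).
  by move=> i; move: (H (lift ord0 i)); rewrite (cons_cVS (x, v)).
move=> [Hx Hv] i; have [j ->|->] := unliftP ord0 i.
  by rewrite (cons_cVS (x, v)); exact: Hv.
by rewrite (cons_cV0 (x, v)).
Qed.

End lebesgue_cV.

(* The powers t and 1 - t are positive, so that 0 `^ t = 0 `^ (1 - t) = 0. *)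
Definition log_concave (R : realType) (V : lmodType R) (C : set V)
    (f : V -> R) : Prop :=
  (forall a, C a -> 0 <= f a) /\
  (forall (t : R) (a b : V), 0 < t < 1 -> C a -> C b ->
    C ((1 - t) *: a + t *: b) ->
    f a `^ (1 - t) * f b `^ t <= f ((1 - t) *: a + t *: b)).

Definition affine_on (R : realType) (k : nat) (Gam : set 'cV[R]_k)
    (f : 'cV[R]_k -> R) : Prop :=
  exists (l : {scalar 'cV[R]_k}) (b : R), forall g, Gam g -> f g = l g + b.

Section probability.
Context {disp : measure_display} {Omega : measurableType disp} {R : realType}.
Variable P : probability Omega R.

Definition has_lebesgue_density (n : nat) (Z : {RV P >-> 'cV[R]_n})
    (f : 'cV[R]_n -> R) : Prop :=
  [/\ measurable_fun setT f, (forall z, 0 <= f z) &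
      forall A : set 'cV[R]_n, measurable A ->
        distribution P Z A = (\int[lebesgue_cV n]_(z in A) (f z)%:E)%E].

Definition sigma_of d (T : measurableType d) (Z : Omega -> T) :
    set (set Omega) :=
  preimage_set_system setT Z measurable.

Definition mutually_independent (I : finType) (F : I -> set (set Omega)) :
    Prop :=
  forall (J : {set I}) (A : I -> set Omega),
    (forall j, j \in J -> F j (A j)) ->
    P (\bigcap_(j in [set` J]) A j) = (\prod_(j in J) P (A j))%E.

Definition independent (F G : set (set Omega)) : Prop :=
  forall A B, F A -> G B -> P (A `&` B) = (P A * P B)%E.

(* The sigma-algebras generated by the common shock (None) and by the shock of
   player i (Some i). *)
Definition shock_sigma n (d : nat) (dd : 'I_n -> nat) (lam : Omega -> 'cV[R]_d)
    (eps : forall i, Omega -> 'cV[R]_(dd i)) (o : option 'I_n) :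
    set (set Omega) :=
  if o is Some i then sigma_of (eps i) else sigma_of lam.

End probability.

Definition profile (n : nat) (Y : 'I_n -> finType) : Type := forall i, Y i.

Section game.
Context {R : realType} {n d : nat} {Y : 'I_n -> finType} {dd : 'I_n -> nat}
  {X : Type}.

Definition payoff (k : nat) (Sigma : Type)
    (v : forall i : 'I_n, 'cV[R]_k -> profile Y -> X -> R)
    (r : forall i : 'I_n, Y i -> 'cV[R]_(dd i))
    (S : forall i : 'I_n, Sigma -> 'M[R]_(dd i, d))
    (gamma : 'cV[R]_k) (sigma : Sigma)
    (i : 'I_n) (y : profile Y) (x : X) (l : 'cV[R]_d) (e : 'cV[R]_(dd i)) : R :=
  v i gamma y x + ((r i (y i))^T *m S i sigma *m l) 0 0
    + ((r i (y i))^T *m e) 0 0.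

(* The profile (a, y_{-i}). *)
Definition deviate (y : profile Y) (i : 'I_n) (a : Y i) : profile Y :=
  dfwith y i a.

(* The payoff at a fixed parameter. *)
Variable u : forall i : 'I_n, profile Y -> X -> 'cV[R]_d -> 'cV[R]_(dd i) -> R.

Definition nash (x : X) (l : 'cV[R]_d) (e : forall i, 'cV[R]_(dd i)) :
    set (profile Y) :=
  [set y : profile Y | forall (i : 'I_n) (a : Y i),
     @u i (deviate y a) x l (e i) <= @u i y x l (e i)].

Definition gain (i : 'I_n) (a : Y i) (y : profile Y) (x : X) (l : 'cV[R]_d)
    (e : 'cV[R]_(dd i)) : R :=
  @u i y x l e - @u i (deviate y a) x l e.

Context {disp : measure_display} {Omega : measurableType disp}.
Variable P : probability Omega R.

(* As the shocks are independent of the covariate and of each other, the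
   conditional probabilities given x (and the common shock l) are computed with
   x (and l) held fixed, under the law of the remaining shocks. *)
Definition best_response_prob (eps : forall i, Omega -> 'cV[R]_(dd i))
    (i : 'I_n) (y : profile Y) (x : X) (l : 'cV[R]_d) : R :=
  fine (P [set w | forall a : Y i, 0 <= gain a y x l (eps i w)]).

Definition cond_likelihood (eps : forall i, Omega -> 'cV[R]_(dd i))
    (y : profile Y) (x : X) (l : 'cV[R]_d) : R :=
  fine (P [set w | nash x l (fun i => eps i w) y]).

Definition likelihood (lam : Omega -> 'cV[R]_d)
    (eps : forall i, Omega -> 'cV[R]_(dd i)) (y : profile Y) (x : X) : R :=
  fine (P [set w | nash x (lam w) (fun i => eps i w) y]).

End game.

(* Main.v *)
Require Import Defs.
From HB Require Import structures.
From mathcomp Require Import all_boot all_order all_algebra.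
From mathcomp Require Import all_classical all_reals all_analysis.
From mathcomp Require Import measurable_realfun ring lra.

Set Implicit Arguments.
Unset Strict Implicit.
Unset Printing Implicit Defensive.
Import Order.TTheory GRing.Theory Num.Theory.
Import numFieldNormedType.Exports.
Local Open Scope classical_set_scope.
Local Open Scope ring_scope.

(* A Nash equilibrium at y is the conjunction over the players i of events that
   involve eps_i only, so independence gives the product formula, and Fubini for
   the pair (lam, eps) gives the integral formula.  Each gain is affine in
   (gamma, lam, eps_i) jointly, hence the best-response regions are stable under
   convex combinations of these three variables, and log-concavity follows from
   the Prekopa-Leindler inequality, applied to q_i for M_i and to
   L(y | x, lam) h(lam) for L(y | x).
   Prekopa-Leindler is proved in dimension one from the Brunn-Minkowski
   inequality for level sets and the layer-cake formula, and in dimension n by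
   integrating out one coordinate at a time. *)

(** * Brunn-Minkowski inequality on the line *)

Lemma powR_amgm (R : realType) (t x y : R) : 0 < t < 1 -> 0 <= x -> 0 <= y ->
  x `^ (1 - t) * y `^ t <= (1 - t) * x + t * y.
Proof.
move=> /andP[t0 t1] x0 y0; have t10 : 0 < 1 - t by rewrite subr_gt0.
(* Young's inequality with the conjugate exponents [(1 - t)^-1] and [t^-1], which cancel the powers
   on the right. *)
have := @conjugate_powR R (x `^ (1 - t)) (y `^ t) (1 - t)^-1 t^-1.
rewrite !powR_ge0 !invr_gt0 !invrK subrK -!powRrM !mulfV ?gt_eqF// !powRr1//.
by rewrite ![_ * (1 - t)]mulrC ![_ * t]mulrC; exact.
Qed.

(** Wraps a pushforward as a bundled measure with its defining equation, so that the uniqueness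
    theorems for measures apply to it. *)
Lemma pushforward_measure_of d1 d2 (T1 : measurableType d1)
    (T2 : measurableType d2) (R : realType) (mu : {measure set T1 -> \bar R})
    (f : T1 -> T2) : measurable_fun setT f ->
  {m : {measure set T2 -> \bar R} | forall A, m A = mu (f @^-1` A)}.
Proof.
move=> mf.
unshelve eexists
    (measure_function_pushforward__canonical__measure_function_Measure mu _);
    first exact: f.
  exact: mf.
by [].
Qed.

(** The pushforward of Lebesgue measure under the affine map, rescaled by [k^-1], gives each []a,
    b]] its length, and this characterises Lebesgue measure. *)
Lemma lebesgue_measure_affine (R : realType) (k c : R)
    (A : set (measurableTypeR R)) : 0 < k -> measurable A ->
  lebesgue_measure ((fun x => (x - c) / k) @^-1` A) =
  (k%:E * lebesgue_measure A)%E.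
Proof.
move=> k0 mA; pose phi (x : measurableTypeR R) : measurableTypeR R :=
  (x - c) / k.
have mphi : measurable_fun setT phi.
  by apply: measurable_funM => //; exact: measurable_funB.
have k'0 : 0 <= k^-1 by rewrite invr_ge0 ltW.
have [mu' mu'E] := pushforward_measure_of (lebesgue_measure : {measure set
    (measurableTypeR R) -> \bar R}) mphi.
suff -> : lebesgue_measure A = mscale (NngNum k'0) mu' A.
  by rewrite /mscale /= mu'E muleA -EFinM mulfV ?gt_eqF// mul1e.
apply: lebesgue_measure_unique => // X [[a b]] _ <- /=.
rewrite /mscale /= mu'E.
have -> : phi @^-1` `]a, b]%classic = `](a * k + c), (b * k + c)]%classic.
  apply/seteqP; split=> x /=; rewrite !in_itv /= /phi;
  by rewrite ltr_pdivlMr// ler_pdivrMr// ltrBrDr lerBlDr.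
rewrite [RHS]/= !lebesgue_measure_itv /= !lte_fin ltrD2r ltr_pM2r//.
case: ifP => _; last by rewrite mule0.
rewrite -!EFinB -EFinM; congr (_%:E).
by field; rewrite gt_eqF.
Qed.

(* C contains the disjoint sets (1-t)A' + tb and (1-t)a + tB', where A' is the
   part of A below a and B' the part of B from b on; the rest of A and of B has
   small measure when a is close to sup A and b to inf B. *)
Lemma brunn_minkowski1 (R : realType) (t : R)
    (A B C : set (measurableTypeR R)) : 0 < t < 1 ->
  measurable A -> measurable B -> measurable C ->
  A !=set0 -> B !=set0 -> has_ubound A -> has_lbound B ->
  (forall x y, A x -> B y -> C ((1 - t) * x + t * y)) ->
  ((1 - t)%:E * lebesgue_measure A + t%:E * lebesgue_measure B <=
    lebesgue_measure C)%E.
Proof.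
move=> /andP[t0 t1] mA mB mC A0 B0 ubA lbB ABC.
have t10 : 0 < 1 - t by rewrite subr_gt0.
apply/lee_addgt0Pr => e e0.
have [a Aa Aae] : exists2 a, A a & sup A - e < a by exact: sup_adherent.
have [b Bb Bbe] : exists2 b, B b & b < inf B + e by exact: inf_adherent.
have leA : (lebesgue_measure A <= lebesgue_measure (A `&` `]-oo, a[) + e%:E)%E.
  rewrite -[in leLHS](setIT A) (_ : setT = `]-oo, a[ `|` `[a, +oo[); last first.
    by apply/seteqP; split=> // x _ /=; rewrite !in_itv /= andbT; case: ltP;
        [left|right].
  rewrite setIUr; apply: (le_trans (measureU2 _ _ _)); try exact: measurableI.
  rewrite leeD2l//.
  apply: (@le_trans _ _ (lebesgue_measure `[a, sup A]%classic)).
    apply: le_measure; rewrite ?inE//; first exact: measurableI.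
    move=> x [Ax] /=; rewrite !in_itv /= andbT => ->/=.
    exact: ub_le_sup.
  rewrite lebesgue_measure_itv /=; case: ifP => _; last by rewrite lee_fin ltW.
  by rewrite -EFinB lee_fin lerBlDr -lerBlDl ltW.
have leB : (lebesgue_measure B <= lebesgue_measure (B `&` `[b, +oo[) + e%:E)%E.
  rewrite -[in leLHS](setIT B) (_ : setT = `[b, +oo[ `|` `]-oo, b[); last first.
    by apply/seteqP; split=> // x _ /=; rewrite !in_itv /= andbT; case: ltP;
        [right|left].
  rewrite setIUr; apply: (le_trans (measureU2 _ _ _)); try exact: measurableI.
  rewrite leeD2l//.
  apply: (@le_trans _ _ (lebesgue_measure `[inf B, b]%classic)).
    apply: le_measure; rewrite ?inE//; first exact: measurableI.
    move=> x [Bx] /=; rewrite !in_itv /= => /ltW ->; rewrite andbT.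
    exact: ge_inf.
  rewrite lebesgue_measure_itv /=; case: ifP => _; last by rewrite lee_fin ltW.
  by rewrite -EFinB lee_fin lerBlDl ltW.
have mphi (k c : R) : measurable_fun [set: measurableTypeR R] (fun x :
    measurableTypeR R => (x - c) / k : measurableTypeR R).
  by apply: measurable_funM => //; exact: measurable_funB.
set A' := A `&` _ in leA; set B' := B `&` _ in leB.
have mA' : measurable A' by exact: measurableI.
have mB' : measurable B' by exact: measurableI.
pose A'' := (fun x => (x - t * b) / (1 - t)) @^-1` A'.
pose B'' := (fun x => (x - (1 - t) * a) / t) @^-1` B'.
have mA'' : measurable A'' by rewrite -[A'']setTI; exact: mphi.
have mB'' : measurable B'' by rewrite -[B'']setTI; exact: mphi.
(* Points of [A''] lie strictly below [(1 - t) * a + t * b], points of [B''] at or above it. *)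
have AB0 : A'' `&` B'' = set0.
  apply/seteqP; split=> // x [[_ /=]] /[swap] -[_ /=]; rewrite !in_itv /= andbT.
  by rewrite ltr_pdivrMr// ler_pdivlMr// => h1 h2; lra.
have le : ((1 - t)%:E * lebesgue_measure A' + t%:E * lebesgue_measure B' <=
    lebesgue_measure C)%E.
  rewrite -(lebesgue_measure_affine (t * b) t10)//.
  rewrite -(lebesgue_measure_affine ((1 - t) * a) t0)//.
  have <- : lebesgue_measure (A'' `|` B'') =
    (lebesgue_measure A'' + lebesgue_measure B'')%E by exact: measureU.
  apply: le_measure; rewrite ?inE//; first exact: measurableU.
  move=> x [[]|[]] /= Hx _.
    rewrite [x](_ : _ = (1 - t) * ((x - t * b) / (1 - t)) + t * b); first exact:
        ABC.
    by field; rewrite gt_eqF.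
  rewrite [x](_ : _ = (1 - t) * a + t * ((x - (1 - t) * a) / t)); first exact:
      ABC.
  by field; rewrite gt_eqF.
apply: (le_trans _ (leeD2r e%:E le)).
(* The two errors, weighted by [1 - t] and [t], add up to exactly [e]. *)
have -> : e%:E = ((1 - t)%:E * e%:E + t%:E * e%:E)%E.
  by rewrite -!EFinM -EFinD -mulrDl subrK mul1r.
rewrite addeACA -!muleDr// ?ge0_adde_def ?inE ?measure_ge0 ?lee_fin ?(ltW e0)//.
by apply: leeD; rewrite lee_pmul2l// lte_fin.
Qed.

(** * Layer-cake formula *)

Section layer_cake.
Context d (T : measurableType d) (R : realType).
Variable mu : {sigma_finite_measure set T -> \bar R}.
Variables (f : T -> R) (mf : measurable_fun setT f) (f0 : forall x, 0 <= f x).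

Lemma measurable_subgraph :
  measurable [set p : T * measurableTypeR R | 0 <= p.2 < f p.1].
Proof.
have m1 : measurable_fun setT (fun p : T * measurableTypeR R => 0 <= p.2).
  by apply: measurable_fun_ler.
have m2 : measurable_fun setT (fun p : T * measurableTypeR R => p.2 < f p.1).
  by apply: measurable_fun_ltr => //; exact: measurableT_comp.
have m12 := measurable_and m1 m2.
by have := m12 measurableT [set true]; rewrite setTI; apply.
Qed.

Lemma measurable_level_set s : measurable [set x | 0 <= s < f x].
Proof.
have := measurable_ysection s measurable_subgraph.
by congr measurable; apply/seteqP; split=> x /=; rewrite /ysection /= inE.
Qed.

Lemma measurable_fun_level_set :
  measurable_fun setT
    (fun s : measurableTypeR R => mu [set x | 0 <= s < f x]).
Proof.
have := measurable_fun_ysection mu measurable_subgraph.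
congr measurable_fun; apply/funext => s /=; congr (mu _).
by apply/seteqP; split=> x /=; rewrite /ysection /= inE.
Qed.

(** Since [f x] is the length of [[0, f x[], both sides are iterated integrals of [w] over the
    subgraph of [f], exchanged by Tonelli. The weight will carry a density. *)
Lemma weighted_layer_cake (w : T -> \bar R) :
  measurable_fun setT w -> (forall x, 0 <= w x)%E ->
  (\int[mu]_x (w x * (f x)%:E) =
   \int[lebesgue_measure]_s \int[mu]_(x in [set x | 0 <= s < f x]%R) w x)%E.
Proof.
move=> mw w0.
pose G := [set p : T * measurableTypeR R | 0 <= p.2 < f p.1].
have mG : measurable G := measurable_subgraph.
have mwG : measurable_fun setT (fun p : T * measurableTypeR R => (w p.1 * (\1_G
    p)%:E)%E).
  by apply: emeasurable_funM; [exact: measurableT_comp|exact/measurable_EFinP].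
have wG0 p : (0 <= w p.1 * (\1_G p)%:E)%E by rewrite mule_ge0// lee_fin.
transitivity (\int[mu]_x \int[lebesgue_measure]_s (w x * (\1_G (x, s))%:E))%E.
  apply: eq_integral => x _.
  rewrite ge0_integralZl//; last first.
    by apply/measurable_EFinP; apply: (measurable_fun_pair2 x); exact:
        measurable_indic.
  congr (_ * _)%E.
  rewrite (_ : (fun s => (\1_G (x, s))%:E) = (fun s => (\1_`[0, f x[%classic
      s)%:E)).
    rewrite integral_indic// setIT; apply/esym/(etrans (lebesgue_measure_itv
        _)).
    rewrite /= lte_fin sube0.
    by case: ltP => // fx0; congr (_%:E); apply/eqP; rewrite eq_le fx0 f0.
  apply/funext => s; rewrite !indicE; congr (((nat_of_bool _)%:R)%:E).

rewrite (fubini_tonelli (fun p : T * measurableTypeR R => (w p.1 * (\1_G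
    p)%:E)%E))//.
apply: eq_integral => s _.
rewrite [RHS]integral_mkcond; apply: eq_integral => x _ /=.
rewrite patchE indicE /G.
case: ifPn => [|]; first by rewrite !inE /= => H; rewrite mem_set//= mule1.
by move=> H; rewrite (_ : _ \in _ = false) ?mule0//; apply: contraNF H; rewrite
    !inE.
Qed.

Lemma layer_cake :
  (\int[mu]_x (f x)%:E =
   \int[lebesgue_measure]_s mu [set x | 0 <= s < f x]%R)%E.
Proof.
have := @weighted_layer_cake (cst 1%E).
rewrite (eq_integral (EFin \o f)); last by move=> x _; rewrite mul1e.
move=> -> //.
by apply: eq_integral => s _; rewrite integral_cst ?mul1e//; exact:
    measurable_level_set.
Qed.

End layer_cake.

(** * Prekopa-Leindler inequality *)

(* [r^(1-t) s^t <= c], with the convention [0 * +oo = 0]; quantifying over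
   strict real minorants makes the relation stable under integration without any
   case distinction on infinite values. *)
Definition geo_le (R : realType) (t : R) (a b c : \bar R) : Prop :=
  forall r s : R, 0 < r -> 0 < s -> (r%:E < a)%E -> (s%:E < b)%E ->
    ((r `^ (1 - t) * s `^ t)%:E <= c)%E.

(** The minima of [f] and [N], cut off outside [[-N, N]], increase to [f], so by monotone
    convergence one of them keeps an integral above [r]. Bounded values and support supply the
    finite suprema and bounded level sets that Brunn-Minkowski requires. *)
Lemma bounded_minorant (R : realType) (f : measurableTypeR R -> \bar R) (r : R)
    :
  measurable_fun setT f -> (forall x, 0 <= f x)%E ->
  (r%:E < \int[lebesgue_measure]_x f x)%E ->
  exists (g : measurableTypeR R -> R) (K : R),
    [/\ measurable_fun setT g, forall x, 0 <= g x <= K,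
        forall x, g x != 0 -> - K <= x <= K,
        forall x, ((g x)%:E <= f x)%E &
        (r%:E < \int[lebesgue_measure]_x (g x)%:E)%E].
Proof.
move=> mf f0 rf.
pose I N : set (measurableTypeR R) := `[- N%:R, N%:R]%classic.
pose g N x := fine (mine (f x) N%:R%:E) * \1_(I N) x.
have min0 N x : (0 <= mine (f x) N%:R%:E)%E by rewrite le_min f0 lee_fin ler0n.
have minfin N x : mine (f x) N%:R%:E \is a fin_num.
  rewrite ge0_fin_numE//; apply: (le_lt_trans _ (ltry N%:R)).
  by rewrite ge_min lexx orbT.
have mg N : measurable_fun setT (g N).
  apply: measurable_funM; last by apply: measurable_indic; exact:
      measurable_itv.
  by apply: measurableT_comp => //; apply: measurable_mine.
have gE N x : (g N x)%:E = if x \in I N then mine (f x) N%:R%:E else 0%E.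
  by rewrite /g indicE; case: ifP => _; rewrite ?mulr0// mulr1 fineK.
have g0 N x : 0 <= g N x by rewrite mulr_ge0// fine_ge0.
have ndg x : nondecreasing_seq (fun N => (g N x)%:E).
  move=> m n mn; rewrite !gE.
  have mn' : m%:R <= n%:R :> R by rewrite ler_nat.
  case: ifPn => [|_]; last by case: ifP.
  rewrite inE /I /= in_itv /= => /andP[mx xm].
  rewrite mem_set /I/= ?in_itv/=; last first.
    by rewrite (le_trans _ mx) ?(le_trans xm)// lerN2.
  by rewrite le_min !ge_min lexx/= lee_fin mn' orbT.
have cvg_g x : (fun N => (g N x)%:E) @ \oo --> f x.
  have [k xk] : exists k, `|x| <= k%:R.
    exists (Num.truncn `|x|).+1; exact/ltW/truncnS_gt.
  have gk N : (k <= N)%N -> (g N x)%:E = mine (f x) N%:R%:E.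
    move=> kN; rewrite gE mem_set// /I/= in_itv /= -ler_norml.
    by rewrite (le_trans xk)// ler_nat.
  (* A finite value is attained from some [N] on; at an infinite value the truncation is eventually
     [N] itself. *)
  case: (f x) (f0 x) gk => [y| |]// y0 gk.
    apply: cvg_near_cst; near=> N.
    rewrite gk; last by near: N; exact: nbhs_infty_ge.
    apply/min_idPl; rewrite lee_fin; near: N.
    exact: nbhs_infty_ger.
  apply/cvgeyPge => M; near=> N.
  rewrite gk; last by near: N; exact: nbhs_infty_ge.
  by rewrite minye lee_fin; near: N; exact: nbhs_infty_ger.
have icvg : (fun N => \int[lebesgue_measure]_x (g N x)%:E)%E @ \oo -->
    (\int[lebesgue_measure]_x f x)%E.
  have := @cvg_monotone_convergence _ _ _ lebesgue_measure setT measurableT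
    (fun N x => (g N x)%:E).
  rewrite (_ : (fun x => limn _) = f); last first.
    by apply/funext => x; exact/cvg_lim.
  apply => //.
  - by move=> N; exact/measurable_EFinP.
  - by move=> N x _; rewrite lee_fin.
have [N rN] : exists N, (r%:E < \int[lebesgue_measure]_x (g N x)%:E)%E.
  apply/not_existsP => H; move: rf; apply/negP; rewrite -leNgt.
  rewrite -(cvg_lim _ icvg)//; apply: lime_le; first exact: cvgP icvg.
  by apply: nearW => N; rewrite leNgt; apply/negP; exact: H.

exists (g N), N%:R; split => //.
- by move=> x; rewrite g0/= -lee_fin gE; case: ifP => _; rewrite ?ge_min ?lexx
    ?orbT ?lee_fin.
- move=> x; rewrite /g indicE; have [|] := boolP (x \in I N); last by rewrite
    mulr0 eqxx.
  by rewrite inE /I/= in_itv.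
- by move=> x; rewrite gE; case: ifP => _; rewrite ?ge_min ?lexx.
Unshelve. all: by end_near.
Qed.

Lemma ge0_integral_convex_le d (T : measurableType d) (R : realType)
    (mu : {measure set T -> \bar R}) (t : R) (f g h : T -> \bar R) :
  0 < t < 1 -> (forall x, 0 <= h x)%E -> (forall x, 0 <= g x)%E ->
  (forall x, 0 <= f x)%E ->
  measurable_fun setT f -> measurable_fun setT g -> measurable_fun setT h ->
  (forall x, (1 - t)%:E * f x + t%:E * g x <= h x)%E ->
  ((1 - t)%:E * \int[mu]_x f x + t%:E * \int[mu]_x g x <= \int[mu]_x h x)%E.
Proof.
move=> /andP[t0 t1] h0 g0 f0 mf mg mh fgh.
have t0' : (0 <= t%:E)%E by rewrite lee_fin ltW.
have t1' : (0 <= (1 - t)%:E)%E by rewrite lee_fin subr_ge0 ltW.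
rewrite -(ge0_integralZl _ _ _ (fun x _ => f0 x))//.
rewrite -(ge0_integralZl _ _ _ (fun x _ => g0 x))//.
rewrite -ge0_integralD//; last 4 first.
- by move=> x _; rewrite mule_ge0.
- exact: measurable_funeM.
- by move=> x _; rewrite mule_ge0.
- exact: measurable_funeM.
apply: ge0_le_integral => //.
- by move=> x _; rewrite adde_ge0// mule_ge0.
- by apply: emeasurable_funD; exact: measurable_funeM.
Qed.

(* After rescaling both functions to supremum [1], every level set below height
   [1] is nonempty, so that Brunn-Minkowski applies to it. *)
Lemma prekopa_leindler_bounded (R : realType) (t K L a b : R)
    (f g : measurableTypeR R -> R) (h : measurableTypeR R -> \bar R) :
  0 < t < 1 ->
  measurable_fun setT f -> measurable_fun setT g -> measurable_fun setT h ->
  (forall x, 0 <= f x <= K) -> (forall x, f x != 0 -> - K <= x <= K) ->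
  (forall x, 0 <= g x <= L) -> (forall x, g x != 0 -> - L <= x <= L) ->
  (forall x, 0 <= h x)%E ->
  (forall x y, geo_le t (f x)%:E (g y)%:E (h ((1 - t) * x + t * y)%R)) ->
  0 < a -> (a%:E < \int[lebesgue_measure]_x (f x)%:E)%E ->
  0 < b -> (b%:E < \int[lebesgue_measure]_x (g x)%:E)%E ->
  ((a `^ (1 - t) * b `^ t)%:E <= \int[lebesgue_measure]_x h x)%E.
Proof.
move=> t01 mf mg mh f0K fK g0L gL h0 fgh a0 af b0 bg.
have /andP[t0 t1] := t01; have t10 : 0 < 1 - t by rewrite subr_gt0.
(* If the supremum were not positive, the nonnegative [u] would vanish and its integral could not
   exceed [c]. *)
have pos_sup (u : measurableTypeR R -> R) (M c : R) : 0 < c ->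
    (forall x, 0 <= u x <= M) ->
    (c%:E < \int[lebesgue_measure]_x (u x)%:E)%E ->
    0 < sup (range u) /\ has_sup (range u).
  move=> c0 uM cu.
  have hs : has_sup (range u).
    split; first by exists (u 0), 0.
    by exists M => _ [x _ <-]; have /andP[] := uM x.
  split=> //; rewrite ltNge; apply/negP => sup0; move: cu; apply/negP.
  rewrite -leNgt (eq_integral (cst 0%E)) ?integral0 ?lee_fin ?ltW//.
  move=> x _ /=; congr (_%:E); apply/eqP; rewrite eq_le.
  have /andP[-> _] := uM x; rewrite andbT (le_trans _ sup0)//.
  by apply: sup_upper_bound => //; exists x.
have [al0 hsf] := pos_sup f K a a0 f0K af.
have [be0 hsg] := pos_sup g L b b0 g0L bg.
set al := sup (range f) in al0; set be := sup (range g) in be0.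
pose ka := al `^ (1 - t) * be `^ t.
have ka0 : 0 < ka by rewrite mulr_gt0// powR_gt0.
pose f' x := f x / al; pose g' x := g x / be.
(* Cutting [h] at [ka] makes it real-valued and leaves the level sets of [h / ka] below height 1
   unchanged. *)
pose h' x := fine (mine (h x) ka%:E) / ka.
have min0 x : (0 <= mine (h x) ka%:E)%E by rewrite le_min h0 lee_fin ltW.
have minfin x : mine (h x) ka%:E \is a fin_num.
  rewrite ge0_fin_numE//; apply: (le_lt_trans _ (ltry ka)).
  by rewrite ge_min lexx orbT.
have mf' : measurable_fun setT f' by exact: measurable_funM.
have mg' : measurable_fun setT g' by exact: measurable_funM.
have mh' : measurable_fun setT h'.
  apply: measurable_funM => //; apply: measurableT_comp => //.
  by apply: measurable_mine.
have f'0 x : 0 <= f' x by have /andP[? _] := f0K x; rewrite divr_ge0// ltW.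
have g'0 x : 0 <= g' x by have /andP[? _] := g0L x; rewrite divr_ge0// ltW.
have h'0 x : 0 <= h' x by rewrite divr_ge0 ?fine_ge0// ltW.
have f'1 x : f' x <= 1.
  by rewrite ler_pdivrMr// mul1r; apply: sup_upper_bound => //; exists x.
have g'1 x : g' x <= 1.
  by rewrite ler_pdivrMr// mul1r; apply: sup_upper_bound => //; exists x.
have level_ne (u : measurableTypeR R -> R) (s : R) : 0 < sup (range u) ->
    has_sup (range u) -> 0 <= s -> s < 1 ->
    exists x, 0 <= s < u x / sup (range u).
  move=> su0 hsu s0 s1.
  have [||_ [x _ <-] ux] := @sup_adherent _ (range u) (sup (range u) * (1 - s))
      _ _ => //.
    by rewrite mulr_gt0// subr_gt0.
  exists x; rewrite s0/= ltr_pdivlMr//; move: ux; congr (_ < _); ring.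
have level_le s : ((1 - t)%:E * lebesgue_measure [set x | 0 <= s < f' x]%R
    + t%:E * lebesgue_measure [set x | 0 <= s < g' x]%R <=
    lebesgue_measure [set x | 0 <= s < h' x]%R)%E.
  (* Outside [[0, 1[] the level sets of [f'] and [g'] are empty, both functions being at most 1. *)
  have [s01|s01] := boolP (0 <= s < 1); last first.
    rewrite (_ : [set x | 0 <= s < f' x] = set0); last first.
      apply/seteqP; split=> // x /= /andP[s0 sf]; move: s01.
      by rewrite s0 (lt_le_trans sf).
    rewrite (_ : [set x | 0 <= s < g' x] = set0); last first.
      apply/seteqP; split=> // x /= /andP[s0 sf]; move: s01.
      by rewrite s0 (lt_le_trans sf).
    by rewrite !measure0 !mule0 adde0.
  have /andP[s0 s1] := s01.
  apply: brunn_minkowski1 => //; try exact: measurable_level_set.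
  - exact: level_ne.
  - exact: level_ne.
  - exists K => x /= /andP[_ H]; have /andP[//] : - K <= x <= K.
    apply: fK; apply/negP => /eqP fx0; move: H; rewrite /f' fx0 mul0r.
    by rewrite ltNge s0.
  - exists (- L) => x /= /andP[_ H]; have /andP[//] : - L <= x <= L.
    apply: gL; apply/negP => /eqP fx0; move: H; rewrite /g' fx0 mul0r.
    by rewrite ltNge s0.
  move=> x y /= /andP[_ sf] /andP[_ sg]; rewrite s0/=.
  pose m := Num.min (f' x) (g' y).
  have sm : s < m by rewrite lt_min sf sg.
  (* [geo_le] gives a weak bound on [h] from strict minorants, whereas the level set of [h'] is
     strict; an intermediate height [s'] absorbs the difference. *)
  have [s' ss' s'm] : exists2 s', s < s' & s' < m by exists ((s + m) / 2); lra.
  have s'0 : 0 < s' by rewrite (le_lt_trans s0).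
  have s'1 : s' < 1 by rewrite (lt_le_trans s'm)// ge_min f'1.
  move: s'm; rewrite lt_min /f' /g' !ltr_pdivlMr// => /andP[s'f s'g].
  have : (((s' * al) `^ (1 - t) * (s' * be) `^ t)%:E <=
      h ((1 - t) * x + t * y)%R)%E.
    by apply: (fgh x y); rewrite ?lte_fin// mulr_gt0.
  rewrite !powRM ?(ltW s'0) ?(ltW al0) ?(ltW be0)// mulrACA -/ka -powRD; last
      first.
    by rewrite subrK oner_eq0.
  rewrite subrK powRr1 ?(ltW s'0)// => le.
  apply: (@lt_le_trans _ _ (s' * ka)); first by rewrite ltr_pM2r.
  rewrite -lee_fin fineK// le_min le.
  by rewrite lee_fin -[leRHS]mul1r ler_wpM2r// ltW.
(* Integrating [level_le] over all heights gives, by the layer-cake formula, an arithmetic-mean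
   inequality for the normalised functions. *)
have int_le : (ka%:E * ((1 - t)%:E * (al^-1%:E * \int[lebesgue_measure]_x (f
    x)%:E)
    + t%:E * (be^-1%:E * \int[lebesgue_measure]_x (g x)%:E))
    <= \int[lebesgue_measure]_x h x)%E.
  have mE (u : measurableTypeR R -> R) : measurable_fun setT u -> measurable_fun
      setT (EFin \o u).
    by move=> ?; exact/measurable_EFinP.
  apply: (@le_trans _ _ (ka%:E * \int[lebesgue_measure]_x (h' x)%:E)%E); last
      first.
    rewrite -ge0_integralZl//; [|exact: mE|by move=> x _; rewrite lee_fin|by
        rewrite lee_fin ltW].
    apply: ge0_le_integral => //.
    - by move=> x _; rewrite mule_ge0// lee_fin// ltW.
    - by apply: measurable_funeM; exact: mE.
    - move=> x _; rewrite -EFinM mulrCA mulfV ?gt_eqF// mulr1 fineK//.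
      by rewrite ge_min lexx.
  rewrite lee_pmul2l//.
  have scale (u : measurableTypeR R -> R) (c : R) : 0 < c ->
      measurable_fun setT u -> (forall x, 0 <= u x / c) ->
     (c^-1%:E * \int[lebesgue_measure]_x (u x)%:E)%E = (\int[lebesgue_measure]_s
        lebesgue_measure [set x | 0 <= s < u x / c]%R)%E.
    move=> c0 mu u0; rewrite -layer_cake//; last exact: measurable_funM.
    rewrite -ge0_integralZl//; [|exact: mE| |by rewrite lee_fin invr_ge0 ltW].
      by apply: eq_integral => x _; rewrite -EFinM mulrC.
    by move=> x _; have := u0 x; rewrite pmulr_lge0 ?invr_gt0// lee_fin.
  rewrite (scale f al)// (scale g be)//.
  rewrite (layer_cake lebesgue_measure mh' h'0).
  move: (measurable_fun_level_set lebesgue_measure mf')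
    (measurable_fun_level_set lebesgue_measure mg')
    (measurable_fun_level_set lebesgue_measure mh') level_le.
  have : forall s, (0 <= lebesgue_measure [set x | 0 <= s < f' x]%R)%E by [].
  have : forall s, (0 <= lebesgue_measure [set x | 0 <= s < g' x]%R)%E by [].
  have : forall s, (0 <= lebesgue_measure [set x | 0 <= s < h' x]%R)%E by [].
  exact: (@ge0_integral_convex_le _ _ _ lebesgue_measure t _ _ _ t01).
apply: (le_trans _ int_le).
have -> : a `^ (1 - t) * b `^ t = ka * ((a / al) `^ (1 - t) * (b / be) `^ t).
  rewrite /ka mulrACA -!powRM ?divr_ge0 ?(ltW a0) ?(ltW b0) ?(ltW al0) ?(ltW
      be0)//.
  by rewrite ![_ * (_ / _)]mulrC !divfK ?gt_eqF.
rewrite EFinM lee_pmul2l//.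
(* The arithmetic mean dominates the geometric one, which restores the multiplicative form. *)
apply: (@le_trans _ _ ((1 - t) * (a / al) + t * (b / be))%:E).
  by rewrite lee_fin powR_amgm// divr_ge0// ltW.
rewrite EFinD !EFinM; apply: leeD.
  by rewrite lee_pmul2l// muleC lee_pmul2l ?lte_fin ?invr_gt0// ltW.
by rewrite lee_pmul2l// muleC lee_pmul2l ?lte_fin ?invr_gt0// ltW.
Qed.
(** Only reals below the two integrals matter, so [f] and [g] may be replaced by bounded minorants
    whose integrals still exceed them; the pointwise hypothesis passes to minorants. *)
Lemma prekopa_leindler1 (R : realType) (t : R)
    (f g h : measurableTypeR R -> \bar R) : 0 < t < 1 ->
  measurable_fun setT f -> measurable_fun setT g -> measurable_fun setT h ->
  (forall x, 0 <= f x)%E -> (forall x, 0 <= g x)%E -> (forall x, 0 <= h x)%E ->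
  (forall x y, geo_le t (f x) (g y) (h ((1 - t) * x + t * y)%R)) ->
  geo_le t (\int[lebesgue_measure]_x f x) (\int[lebesgue_measure]_x g x)
    (\int[lebesgue_measure]_x h x).
Proof.
move=> t01 mf mg mh f0 g0 h0 fgh a b a0 b0 af bg.
have [f' [K [mf' f'0K f'K f'f af']]] := bounded_minorant mf f0 af.
have [g' [L [mg' g'0L g'L g'g bg']]] := bounded_minorant mg g0 bg.
apply: (prekopa_leindler_bounded t01 mf' mg' mh f'0K f'K g'0L g'L h0) => //.
move=> x y r s r0 s0 rf sg.
by apply: (fgh x y) => //; [exact: lt_le_trans rf _|exact: lt_le_trans sg _].
Qed.

Lemma cons_cV_conv (R : realType) n (t x y : R) (u v : 'cV[R]_n) :
  (1 - t) *: cons_cV (x : measurableTypeR R, u) +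
    t *: cons_cV (y : measurableTypeR R, v) =
  cons_cV ((1 - t) * x + t * y : measurableTypeR R, (1 - t) *: u + t *: v).
Proof.
have E m (A B : 'cV[R]_m) i :
    ((1 - t) *: A + t *: B) i ord0 = (1 - t) * A i ord0 + t * B i ord0.
  by rewrite !mxE.
apply/matrixP => i j; rewrite (_ : j = ord0) ?E; last exact: ord1.
have [k ->|->] := unliftP ord0 i; last by rewrite !cons_cV0.
by rewrite !cons_cVS E.
Qed.

(** Tonelli, as the measure on the left is the image under [cons_cV] of a product measure. *)
Lemma ge0_integral_cons_cV (R : realType) n (f : 'cV[R]_n.+1 -> \bar R) :
  measurable_fun setT f -> (forall x, 0 <= f x)%E ->
  (\int[lebesgue_cV n.+1]_z f z =
   \int[lebesgue_measure]_x \int[lebesgue_cV n]_v f (cons_cV (x, v)))%E.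
Proof.
move=> mf f0.
rewrite -(fubini_tonelli1 (fun p : measurableTypeR R * 'cV[R]_n => f (cons_cV
    p)))//; last first.
  by apply: measurableT_comp => //; exact: measurable_cons_cV.
rewrite -[RHS](@ge0_integral_pushforward _ _ _ _ R _ (@measurable_cons_cV R n) _
    setT)//.
Qed.

(** For fixed first coordinates the inductive hypothesis relates the inner integrals by [geo_le],
    which is exactly the hypothesis of the one-dimensional case for the outer integral. *)
Lemma prekopa_leindler (R : realType) n (t : R)
    (f g h : 'cV[R]_n -> \bar R) : 0 < t < 1 ->
  measurable_fun setT f -> measurable_fun setT g -> measurable_fun setT h ->
  (forall x, 0 <= f x)%E -> (forall x, 0 <= g x)%E -> (forall x, 0 <= h x)%E ->
  (forall x y, geo_le t (f x) (g y) (h ((1 - t) *: x + t *: y))) ->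
  geo_le t (\int[lebesgue_cV n]_x f x) (\int[lebesgue_cV n]_x g x)
    (\int[lebesgue_cV n]_x h x).
Proof.
move=> t01; elim: n f g h => [|n IH] f g h mf mg mh f0 g0 h0 fgh.
  (* In dimension 0 the integrals are the values at the only point. *)
  rewrite /= !integral_dirac// !diracT !mul1e.
  have := fgh 0 0; rewrite (_ : (1 - t) *: 0 + _ = 0)//.
  by rewrite !scaler0 addr0.
rewrite !ge0_integral_cons_cV//.
have mc (u : 'cV[R]_n.+1 -> \bar R) : measurable_fun setT u ->
    measurable_fun setT (fun p : measurableTypeR R * 'cV[R]_n => u (cons_cV p)).
  by move=> mu; apply: measurableT_comp => //; exact: measurable_cons_cV.
have mF (u : 'cV[R]_n.+1 -> \bar R) : measurable_fun setT u -> (forall x, 0 <= u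
    x)%E ->
    measurable_fun setT (fun x : measurableTypeR R => \int[lebesgue_cV n]_v u
        (cons_cV (x, v)))%E.
  move=> mu u0.
  exact: (measurable_fun_fubini_tonelli_F (fun p : measurableTypeR R * 'cV[R]_n
      => u (cons_cV p)) (mc _ mu)).
have mx (u : 'cV[R]_n.+1 -> \bar R) (x : measurableTypeR R) : measurable_fun
    setT u ->
    measurable_fun setT (fun v : 'cV[R]_n => u (cons_cV (x, v))).
  by move=> mu; exact: (measurable_fun_pair2 x (mc _ mu)).
apply: prekopa_leindler1 => //; try exact: mF.
- by move=> x; exact: integral_ge0.
- by move=> x; exact: integral_ge0.
- by move=> x; exact: integral_ge0.
move=> x y; apply: IH => //; try exact: mx.
by move=> u v; rewrite -cons_cV_conv; exact: fgh.
Qed.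

(** * Laws with densities, and Fubini under independence *)

(** Both integrals unfold by the layer-cake formula, the right one with weight [f]; at each height
    the density hypothesis equates the masses of the level set. *)
Lemma integral_lebesgue_density d (Omega : measurableType d) (R : realType)
    (P : probability Omega R) n (Z : {RV P >-> 'cV[R]_n}) (f : 'cV[R]_n -> R)
    (psi : 'cV[R]_n -> R) : has_lebesgue_density Z f ->
  measurable_fun setT psi -> (forall z, 0 <= psi z) ->
  (\int[distribution P Z]_z (psi z)%:E =
   \int[lebesgue_cV n]_z (psi z * f z)%:E)%E.
Proof.
move=> [mf f0 Zf] mpsi psi0.
rewrite (layer_cake (distribution P Z) mpsi psi0).
under [RHS]eq_integral do rewrite mulrC EFinM.
rewrite (weighted_layer_cake (lebesgue_cV n) mpsi psi0 (w := EFin \o f))//; last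
    first.
  exact/measurable_EFinP.
by apply: eq_integral => s _; apply: Zf; exact: measurable_level_set.
Qed.

(* The second coordinate is the sample point itself, with the sigma-algebra
   generated by G; for the shocks eps this avoids the product of the R^(d_i). *)
Lemma independent_fubini d d' (Omega : measurableType d) (T : measurableType d')
    (R : realType) (P : probability Omega R) (Z : {RV P >-> T})
    (G : set (set Omega)) (E : set (T * g_sigma_algebraType G)) :
  G `<=` measurable -> G setT -> setI_closed G ->
  (forall A B, measurable A -> G B -> P (Z @^-1` A `&` B) = (P (Z @^-1` A) * P
      B)%E) ->
  measurable E ->
  [/\ measurable_fun setT (fun z => P [set w | E (z, w)]),
      measurable [set w | E (Z w, w)] &
      P [set w | E (Z w, w)] = (\int[distribution P Z]_z P [set w | E (z,
          w)])%E].
Proof.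
move=> Gm GT GI ZG mE.
have sGm : <<s G >> `<=` measurable by apply: smallest_sub => //; exact:
    sigma_algebra_measurable.
have mid : measurable_fun setT (idfun : Omega -> g_sigma_algebraType G).
  by move=> _ B mB; rewrite setTI; exact: sGm.
(* The identity, read as a measurable map to the smaller sigma-algebra; its law [PG] is the
   restriction of [P]. *)
pose pid : {mfun Omega >-> g_sigma_algebraType G} :=
  HB.pack (idfun : Omega -> g_sigma_algebraType G) (isMeasurableFun.Build _ _ _
      _ _ mid).
pose PG := distribution P pid.
have mZ A : measurable A -> measurable (Z @^-1` A).
  by move=> mA; rewrite -[_ @^-1` _]setTI; exact: measurable_funP.
(* For fixed [A] both sides are finite measures in [B] that agree on the pi-system [G], hence on the
   sigma-algebra it generates. *)
have ZsG A (B : set (g_sigma_algebraType G)) : measurable A -> measurable B ->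
    P (Z @^-1` A `&` B) = (P (Z @^-1` A) * P B)%E.
  move=> mA mB.
  have [m1 m1E] := pushforward_measure_of (mrestr P (mZ _ mA)) mid.
  have k0 : 0 <= fine (P (Z @^-1` A)) by rewrite fine_ge0.
  have PAE : (fine (P (Z @^-1` A)))%:E = P (Z @^-1` A).
    by rewrite fineK// fin_num_measure//; exact/mZ.
  pose m2 := mscale (NngNum k0) PG.
  have m2E C : m2 C = (P (Z @^-1` A) * P C)%E by rewrite /m2 /mscale /= PAE.
  rewrite -m2E setIC -[LHS](m1E B).
  apply: (@measure_unique _ R (g_sigma_algebraType G) G (fun=> setT) _ _ _ _ m1
      m2) => //.
  - by rewrite bigcup_const.
  - move=> C GC; rewrite m1E; apply: etrans (esym (m2E C)).
    by rewrite -ZG// /mrestr setIC.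
  - move=> _; rewrite m1E -[X in (X < _)%E]/(P (setT `&` Z @^-1` A)) setTI.
    by rewrite ltey_eq fin_num_measure//; exact/mZ.
have mpair : measurable_fun setT (fun w => (Z w, w : g_sigma_algebraType G)).
  by apply: measurable_fun_pair.
have [m mE'] := pushforward_measure_of P mpair.
have xE z : xsection E z = [set w | E (z, w)].
  by apply/seteqP; split=> w; rewrite /xsection /= inE.
split.
  have := measurable_fun_xsection PG mE.
  by congr measurable_fun; apply/funext => z /=; rewrite xE.
  by have := mpair measurableT E mE; rewrite setTI.
(* The joint law [m] factorises on rectangles, hence is the product measure, whose value at [E] is
   the integral of the sections. *)
transitivity (m E); first by rewrite mE'.
rewrite -(@product_measure_unique _ _ _ _ _ (distribution P Z) PG m)//.
  by apply: eq_integral => z _ /=; rewrite xE.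
by move=> A B mA mB; rewrite mE' /PG /distribution /pushforward /= -ZsG.
Qed.

(** * Log-concavity of probabilities *)

(** A zero integral makes the left side vanish. Otherwise [geo_le] covers only reals strictly below
    [a] and [b]; scaling both by some [k < 1] and using homogeneity reaches the endpoint. *)
Lemma prekopa_leindler_real (R : realType) n (t a b c : R)
    (f g h : 'cV[R]_n -> R) : 0 < t < 1 ->
  measurable_fun setT f -> measurable_fun setT g -> measurable_fun setT h ->
  (forall x, 0 <= f x) -> (forall x, 0 <= g x) -> (forall x, 0 <= h x) ->
  (forall x y, f x `^ (1 - t) * g y `^ t <= h ((1 - t) *: x + t *: y)) ->
  (\int[lebesgue_cV n]_x (f x)%:E = a%:E)%E ->
  (\int[lebesgue_cV n]_x (g x)%:E = b%:E)%E ->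
  (\int[lebesgue_cV n]_x (h x)%:E = c%:E)%E ->
  a `^ (1 - t) * b `^ t <= c.
Proof.
move=> t01 mf mg mh f0 g0 h0 fgh fa gb hc.
have /andP[t0 t1] := t01; have t10 : 0 < 1 - t by rewrite subr_gt0.
have ge0 (u : 'cV[R]_n -> R) k : (forall x, 0 <= u x) ->
    (\int[lebesgue_cV n]_x (u x)%:E = k%:E)%E -> 0 <= k.
  by move=> u0 uk; rewrite -lee_fin -uk integral_ge0// => x _; rewrite lee_fin.
have c0 := ge0 _ _ h0 hc.
have := ge0 _ _ f0 fa; rewrite le_eqVlt => /predU1P[<-|a0].
  by rewrite powR0 ?gt_eqF// mul0r.
have := ge0 _ _ g0 gb; rewrite le_eqVlt => /predU1P[<-|b0].
  by rewrite [0 `^ _]powR0 ?gt_eqF// mulr0.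
have geo : geo_le t a%:E b%:E c%:E.
  rewrite -fa -gb -hc; apply: prekopa_leindler => //; try
      exact/measurable_EFinP.
  move=> x y r s r0 s0; rewrite !lte_fin => rf sg.
  rewrite lee_fin (le_trans _ (fgh x y))// ler_pM ?powR_ge0//.
    by rewrite ge0_ler_powR ?nnegrE// ?ltW.
  by rewrite ge0_ler_powR ?nnegrE// ?ltW.
set X := _ * _; have X0 : 0 < X by rewrite mulr_gt0// powR_gt0.
rewrite leNgt; apply/negP => cX.
(* The witness makes [k * X] the midpoint of [c] and [X]. *)
have [k [k0 k1 kX]] : exists k, [/\ 0 < k, k < 1 & c < k * X].
  have X20 : 0 < 2 * X by rewrite mulr_gt0.
  exists ((c + X) / (2 * X)); split.
  - by rewrite divr_gt0// ltr_wpDl.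
  - by rewrite ltr_pdivrMr//; lra.
  have -> : (c + X) / (2 * X) * X = (c + X) / 2 by field; rewrite gt_eqF.
  by lra.
have : (((k * a) `^ (1 - t) * (k * b) `^ t)%:E <= c%:E)%E.
  by apply: geo; rewrite ?lte_fin ?gtr_pMl// mulr_gt0.
rewrite !powRM ?(ltW k0) ?(ltW a0) ?(ltW b0)// mulrACA -powRD; last first.
  by rewrite subrK oner_eq0.
rewrite subrK powRr1 ?(ltW k0)// -/X lee_fin; apply/negP.
by rewrite -ltNge.
Qed.

(** Prekopa-Leindler for [f] times the indicators of [A], [B] and [C]. *)
Lemma log_concave_density_prob d (Omega : measurableType d) (R : realType)
    (P : probability Omega R) n (Z : {RV P >-> 'cV[R]_n}) (f : 'cV[R]_n -> R)
    (t : R) (A B C : set 'cV[R]_n) :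
  has_lebesgue_density Z f -> log_concave setT f -> 0 < t < 1 ->
  measurable A -> measurable B -> measurable C ->
  (forall a b, A a -> B b -> C ((1 - t) *: a + t *: b)) ->
  fine (P (Z @^-1` A)) `^ (1 - t) * fine (P (Z @^-1` B)) `^ t <=
  fine (P (Z @^-1` C)).
Proof.
move=> [mf f0 Zf] [_ lcf] t01 mA mB mC ABC.
have ind (D : set 'cV[R]_n) : measurable D ->
    (\int[lebesgue_cV n]_z (f z * \1_D z)%:E = (fine (P (Z @^-1` D)))%:E)%E.
  move=> mD; rewrite fineK; last first.
    by rewrite fin_num_measure// -[_ @^-1` _]setTI; exact: measurable_funP.
  apply: etrans (esym (Zf D mD)).
  rewrite [RHS]integral_mkcond; apply: eq_integral => z _.
  by rewrite patchE indicE; case: ifP => _; rewrite ?mulr1 ?mulr0.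
have mi (D : set 'cV[R]_n) : measurable D -> measurable_fun setT (fun z => f z *
    \1_D z).
  by move=> mD; apply: measurable_funM => //; exact: measurable_indic.
apply: (prekopa_leindler_real t01 (mi _ mA) (mi _ mB) (mi _ mC) _ _ _ _ (ind _
    mA) (ind _ mB) (ind _ mC));
  try by move=> x; rewrite mulr_ge0.
have /andP[t0 t1] := t01; have t10 : 0 < 1 - t by rewrite subr_gt0.
move=> x y; rewrite !indicE.
(* Outside [A] or [B] the left side is zero, both exponents being positive. *)
have [xA|xA] := boolP (x \in A); last first.
  by rewrite mulr0 powR0 ?gt_eqF// mul0r mulr_ge0.
have [yB|yB] := boolP (y \in B); last first.
  by rewrite mulr0 [0 `^ _]powR0 ?gt_eqF// mulr0 mulr_ge0.
rewrite mem_set ?mulr1; first exact: lcf.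
by move: xA yB; rewrite !inE; exact: ABC.
Qed.

Lemma log_concave_prod (R : realType) (V : lmodType R) (C : set V) (I : finType)
    (f : I -> V -> R) :
  (forall i, log_concave C (f i)) -> log_concave C (fun p => \prod_i f i p).
Proof.
move=> lcf; split=> [p Cp|t p q t01 Cp Cq Cpq].
  by apply: prodr_ge0 => i _; have [f0 _] := lcf i; exact: f0.
have f0 i z : C z -> 0 <= f i z by have [+ _] := lcf i; exact.
have powR_prod (s : R) (z : V) : C z ->
    (\prod_i f i z) `^ s = \prod_i f i z `^ s.
  (* Nonnegativity of the partial products is carried through the induction because [powRM] requires
     it. *)
  move=> Cz; suff [] : (\prod_i f i z) `^ s = \prod_i f i z `^ s /\ 0 <= \prod_i
      f i z by [].
  elim/big_rec2 : _ => [|i x y _ [<- y0]]; first by rewrite powR1.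
  by rewrite powRM ?mulr_ge0 ?f0.
rewrite !powR_prod// -big_split/=; apply: ler_prod => i _.
by rewrite mulr_ge0 ?powR_ge0//=; have [_] := lcf i; exact.
Qed.

Lemma eq_log_concave (R : realType) (V : lmodType R) (C : set V) (f g : V -> R)
    :
  {in C, f =1 g} -> log_concave C f -> log_concave C g.
Proof.
move=> fg [f0 lcf]; split=> [a Ca|t a b t01 Ca Cb Cab].
  by rewrite -fg ?inE//; exact: f0.
by rewrite -!fg ?inE//; exact: lcf.
Qed.

Lemma measurable_mulmx_entry (R : realType) m p n (A : 'M[R]_(m, p)) i j :
  measurable_fun setT (fun l : 'M[R]_(p, n) => (A *m l) i j).
Proof.
under eq_fun do rewrite mxE.
by apply: measurable_sum => k; apply: measurable_funM => //; exact:
    measurable_fun_coord.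
Qed.

(** * Best-response regions *)

Section game_lemmas.
Context (R : realType) (n k d : nat) (Y : 'I_n -> finType) (dd : 'I_n -> nat)
  (X Sigma : Type).
Variables (Gam : set 'cV[R]_k)
  (v : forall i : 'I_n, 'cV[R]_k -> profile Y -> X -> R)
  (r : forall i : 'I_n, Y i -> 'cV[R]_(dd i))
  (S : forall i : 'I_n, Sigma -> 'M[R]_(dd i, d)).
Variables (sigma : Sigma) (y : profile Y) (x : X).

Let u gamma := payoff v r S gamma sigma.

(** The two shocks form a pair because measurability and convex combinations are required jointly in
    them. *)
Definition best_response_set gamma (i : 'I_n) : set ('cV[R]_d * 'cV[R]_(dd i))
    :=
  [set p | forall a : Y i, 0 <= gain (u gamma) a y x p.1 p.2].
Arguments best_response_set : clear implicits.

(** The shocks enter the payoff only through [r] at the player's own action, so the gain splits into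
    a parameter term and terms linear in [l] and [e]. *)
Lemma gain_payoffE gamma i (a : Y i) (l : 'cV[R]_d) (e : 'cV[R]_(dd i)) :
  gain (u gamma) a y x l e =
  (v i gamma y x - v i gamma (deviate y a) x) +
  (((r (y i))^T *m S i sigma - (r a)^T *m S i sigma) *m l) 0 0 +
  (((r (y i))^T - (r a)^T) *m e) 0 0.
Proof.
rewrite /gain /u /payoff /deviate dfwithin !mulmxBl.
move: (_ *m e) (_ *m e) (_ *m l) (_ *m l) => A B C D.
by rewrite !mxE; ring.
Qed.

Lemma nash_gainP gamma l (e : forall i, 'cV[R]_(dd i)) :
  nash (u gamma) x l e y <-> forall i, best_response_set gamma i (l, e i).
Proof.
by split=> H i a; have := H i a; rewrite /gain subr_ge0.
Qed.

Lemma measurable_best_response gamma i : measurable (best_response_set gamma i).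
Proof.
rewrite (_ : best_response_set gamma i = \bigcap_(a in [set: Y i])
   [set p | 0 <= gain (u gamma) a y x p.1 p.2]); last first.
  by apply/seteqP; split=> p /= H a; [move=> _|]; exact: H.
apply: fin_bigcap_measurable => // a _.
have mg : measurable_fun setT (fun p : 'cV[R]_d * 'cV[R]_(dd i) =>
    0 <= gain (u gamma) a y x p.1 p.2).
  apply: measurable_fun_ler => //.
  under eq_fun do rewrite gain_payoffE.
  by apply: measurable_funD; [apply: measurable_funD => //|];
    apply: (measurableT_comp (measurable_mulmx_entry _ _ _)).
by have := mg measurableT [set true]; rewrite setTI; apply.
Qed.

Hypothesis v_affine : forall i y x, affine_on Gam (fun gamma => v i gamma y x).

(** Membership of the combined parameter in [Gam] gives access to the affine form of [v] there. *)
Lemma best_response_conv (t : R) (g0 g1 : 'cV[R]_k) i l0 l1 e0 e1 :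
  0 < t < 1 -> Gam g0 -> Gam g1 -> Gam ((1 - t) *: g0 + t *: g1) ->
  best_response_set g0 i (l0, e0) -> best_response_set g1 i (l1, e1) ->
  best_response_set ((1 - t) *: g0 + t *: g1) i
    ((1 - t) *: l0 + t *: l1, (1 - t) *: e0 + t *: e1).
Proof.
move=> /andP[t0 t1] G0 G1 Gt H0 H1 a.
have [f [b fb]] := v_affine i y x; have [f' [b' fb']] := v_affine i (deviate y
    a) x.
have lin m (A : 'rV[R]_m) (z0 z1 : 'cV[R]_m) :
    (A *m ((1 - t) *: z0 + t *: z1)) 0 0 =
    (1 - t) * (A *m z0) 0 0 + t * (A *m z1) 0 0.
  by rewrite mulmxDr -!scalemxAr; move: (A *m z0) (A *m z1) => B C; rewrite
      !mxE.
have := H0 a; have := H1 a; rewrite /= !gain_payoffE !lin !fb// !fb'//.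
rewrite !linearD !linearZ /=.
set A0 := f g0; set A1 := f g1; set B0 := f' g0; set B1 := f' g1.
set L0 := (_ *m l0) 0 0; set L1 := (_ *m l1) 0 0.
set E0 := (_ *m e0) 0 0; set E1 := (_ *m e1) 0 0 => h1 h0.
have t10 : 0 <= 1 - t by rewrite subr_ge0 ltW.
(* The constants [b] and [b'] receive weights summing to one, so the combination of the two gains is
   exactly the gain at the combined point. *)
have := addr_ge0 (mulr_ge0 t10 h0) (mulr_ge0 (ltW t0) h1).
congr (0 <= _); rewrite -!/(_ *: _) /GRing.scale /=; ring.
Qed.

End game_lemmas.
Arguments best_response_set {R n k d Y dd X Sigma} v r S sigma y x gamma i.

(** * Independence of the shocks *)

Section shocks.
Context disp (Omega : measurableType disp) (R : realType)
  (P : probability Omega R) (n d : nat) (dd : 'I_n -> nat).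
Variables (lam : {RV P >-> 'cV[R]_d})
  (eps : forall i : 'I_n, {RV P >-> 'cV[R]_(dd i)}).
Hypothesis shocks_indep : mutually_independent P (shock_sigma lam eps).

Lemma measurable_preimage_RV m (Z : {RV P >-> 'cV[R]_m}) (A : set 'cV[R]_m) :
  measurable A -> measurable (Z @^-1` A).
Proof. by move=> mA; rewrite -[_ @^-1` _]setTI; exact: measurable_funP. Qed.

Lemma sigma_of_preimage m (Z : {RV P >-> 'cV[R]_m}) (A : set 'cV[R]_m) :
  measurable A -> sigma_of Z (Z @^-1` A).
Proof. by exists A => //; rewrite setTI. Qed.

Lemma prob_eps_rectangle (B : forall i, set 'cV[R]_(dd i)) :
  (forall i, measurable (B i)) ->
  P (\bigcap_(i in setT) (eps i @^-1` B i)) =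
  (\prod_(i < n) P (eps i @^-1` B i))%E.
Proof.
move=> mB.
pose F (o : option 'I_n) : set Omega := if o is Some i then eps i @^-1` B i else
    setT.
(* This index set omits [None], so that only the players' shocks enter. *)
have := @shocks_indep [set Some i | i in [set: 'I_n]]%SET F.
rewrite big_imset/=; last by move=> i j _ _ [].
under eq_bigl do rewrite finset.in_setT.
move=> <-; last by move=> j /imsetP[i _ ->]; exact: sigma_of_preimage.
congr (P _); apply/seteqP; split=> w H.
  by move=> _ /imsetP[i _ ->]; exact: H.
by move=> i _; apply: (H (Some i)); rewrite /= imset_f// finset.in_setT.
Qed.

Lemma lam_eps_independent (A : set 'cV[R]_d) (B : forall i, set 'cV[R]_(dd i)) :
  measurable A -> (forall i, measurable (B i)) ->
  P (lam @^-1` A `&` \bigcap_(i in setT) (eps i @^-1` B i)) =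
  (P (lam @^-1` A) * P (\bigcap_(i in setT) (eps i @^-1` B i)))%E.
Proof.
move=> mA mB; rewrite prob_eps_rectangle//.
pose F (o : option 'I_n) : set Omega :=
  if o is Some i then eps i @^-1` B i else lam @^-1` A.
have := @shocks_indep [set: option 'I_n]%SET F.
have FE : (\prod_(o in [set: option 'I_n]%SET | o != None) P (F o) =
    \prod_(i < n) P (eps i @^-1` B i))%E.
  have omapK (o : option 'I_n) :
      (o \in [set: option 'I_n]%SET) && (o != None) -> omap Some o = Some o.
    by case: o => // /andP[].
  rewrite (reindex_omap Some id omapK).
  by apply: eq_bigl => i; rewrite finset.in_setT/= eqxx.
rewrite (bigD1 None) ?finset.in_setT//= FE.
move=> <-; last by move=> [i|] _; exact: sigma_of_preimage.
congr (P _); apply/seteqP; split=> w.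
  by move=> [wA wB] [i|] _ //=; exact: wB.
move=> H; split; first by apply: (H None); rewrite /= finset.in_setT.
by move=> i _; apply: (H (Some i)); rewrite /= finset.in_setT.
Qed.

(** A pi-system generating the sigma-algebra of all the players' shocks together. *)
Definition eps_rectangles : set (set Omega) :=
  [set A | exists2 B : forall i, set 'cV[R]_(dd i),
    (forall i, measurable (B i)) & A = \bigcap_(i in setT) (eps i @^-1` B i)].

Lemma eps_rectangles_measurable : eps_rectangles `<=` measurable.
Proof.
move=> _ [B mB ->]; apply: fin_bigcap_measurable => // i _.
exact: measurable_preimage_RV.
Qed.

Lemma eps_rectanglesT : eps_rectangles setT.
Proof. by exists (fun=> setT) => //; apply/seteqP; split. Qed.

Lemma eps_rectanglesI : setI_closed eps_rectangles.
Proof.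
move=> _ _ [B mB ->] [C mC ->]; exists (fun i => B i `&` C i).
  by move=> i; exact: measurableI.
apply/seteqP; split=> w /=; first by move=> [wB wC] i _; split; [exact:
    wB|exact: wC].
by move=> H; split=> i _; have [] := H i Logic.I.
Qed.

Lemma measurable_eps_rectangles i :
  measurable_fun setT (eps i : g_sigma_algebraType eps_rectangles -> _).
Proof.
move=> _ B mB; rewrite setTI; apply: sub_sigma_algebra.
(* The rectangle with side [B] at [i] and full sides elsewhere. *)
exists (dfwith (fun=> setT) i B).
  by move=> j; case: dfwithP.
apply/seteqP; split=> w /=.
  by move=> wB j _; case: dfwithP.
by move=> /(_ i Logic.I); rewrite dfwithin.
Qed.

End shocks.

(** * Likelihood formulas and log-concavity in the game *)

Theorem theorem2 (R : realType) (n k d : nat) (Y : 'I_n -> finType)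
    (dd : 'I_n -> nat) (X Sigma : Type) (Gam : set 'cV[R]_k)
    (v : forall i : 'I_n, 'cV[R]_k -> profile Y -> X -> R)
    (r : forall i : 'I_n, Y i -> 'cV[R]_(dd i))
    (S : forall i : 'I_n, Sigma -> 'M[R]_(dd i, d))
    (disp : measure_display) (Omega : measurableType disp)
    (P : probability Omega R)
    (xi : Omega -> X) (lam : {RV P >-> 'cV[R]_d})
    (eps : forall i : 'I_n, {RV P >-> 'cV[R]_(dd i)})
    (h : 'cV[R]_d -> R) (q : forall i : 'I_n, 'cV[R]_(dd i) -> R)
    (v_affine : forall (i : 'I_n) (y : profile Y) (x : X),
       affine_on Gam (fun gamma => v i gamma y x))
    (xi_measurable : forall C : set X, measurable (xi @^-1` C))
    (shocks_indep : mutually_independent P (shock_sigma lam eps))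
    (shocks_indep_x : independent P
       [set xi @^-1` C | C in [set: set X]]
       <<s \bigcup_(o in [set: option 'I_n]) shock_sigma lam eps o >>)
    (lam_density : has_lebesgue_density lam h)
    (h_log_concave : log_concave setT h)
    (eps_density : forall i : 'I_n, has_lebesgue_density (eps i) (q i))
    (q_log_concave : forall i : 'I_n, log_concave setT (q i)) :
  forall (sigma : Sigma) (y : profile Y) (x : X),
    let u gamma := payoff v r S gamma sigma in
    let M gamma i l := best_response_prob (u gamma) P eps i y x l in
    let Lc gamma l := cond_likelihood (u gamma) P eps y x l in
    let L gamma := likelihood (u gamma) P lam eps y x in
    [/\ forall gamma l, Gam gamma -> Lc gamma l = \prod_(i < n) M gamma i l,
        forall gamma, Gam gamma ->
          (L gamma)%:E =
            (\int[lebesgue_cV d]_l ((\prod_(i < n) M gamma i l) * h l)%:E)%E,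
        forall i : 'I_n,
          log_concave (Gam `*` [set: 'cV[R]_d]) (fun p => M p.1 i p.2),
        log_concave (Gam `*` [set: 'cV[R]_d]) (fun p => Lc p.1 p.2) &
        log_concave Gam L].
Proof.
move=> sigma y x u M Lc L.
pose BRS := best_response_set v r S sigma y x.
pose BR gamma i l := [set e | BRS gamma i (l, e)].
have mBR gamma i l : measurable (BR gamma i l).
  have := measurable_xsection l (@measurable_best_response _ _ _ _ _ _ _ _ v r S
      sigma y x gamma i).
  by congr measurable; apply/seteqP; split=> e; rewrite /xsection /= inE.
have ME gamma i l : (M gamma i l)%:E = P (eps i @^-1` BR gamma i l).
  by rewrite -[RHS]fineK// fin_num_measure//; exact: measurable_preimage_RV.
have nashE gamma l : [set w | nash (u gamma) x l (fun i => eps i w) y] =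
    \bigcap_(i in setT) (eps i @^-1` BR gamma i l).
  apply/seteqP; split=> w.
    by move=> /nash_gainP H i _; exact: H.
  by move=> H; apply/nash_gainP => i; exact: H.
have LcPE gamma l : P [set w | nash (u gamma) x l (fun i => eps i w) y] =
    (\prod_(i < n) M gamma i l)%:E.
  rewrite nashE (prob_eps_rectangle shocks_indep)//.
  rewrite -prodEFin; apply: eq_bigr => i _.
  by rewrite ME.
have LcE gamma l : Lc gamma l = \prod_(i < n) M gamma i l.
  by rewrite /Lc /cond_likelihood LcPE.
have M0 gamma i l : 0 <= M gamma i l by rewrite fine_ge0.
have Lc0 gamma l : 0 <= Lc gamma l by rewrite fine_ge0.
have [mh h0 _] := lam_density.
(* Measurability in the common shock and the integral formula come from the same application of
   Fubini to the equilibrium event. *)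
have LI gamma : measurable_fun setT (Lc gamma) /\
    (L gamma)%:E = (\int[lebesgue_cV d]_l (Lc gamma l * h l)%:E)%E.
  pose E := [set p : 'cV[R]_d * g_sigma_algebraType (eps_rectangles eps) |
    nash (u gamma) x p.1 (fun i => eps i p.2) y].
  have mE : measurable E.
    rewrite (_ : E = \bigcap_(i in setT)
        ((fun p : 'cV[R]_d * g_sigma_algebraType (eps_rectangles eps) =>
           (p.1, eps i p.2)) @^-1` BRS gamma i)); last first.
      apply/seteqP; split=> p.
        by move=> /nash_gainP H i _; exact: H.
      by move=> H; apply/nash_gainP => i; exact: H.
    apply: fin_bigcap_measurable => // i _.
    rewrite -[X in measurable X]setTI.
    have mp : measurable_fun setT (fun p : 'cV[R]_d * g_sigma_algebraType
        (eps_rectangles eps) => (p.1, eps i p.2)).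
      apply: measurable_fun_pair => //.
      exact: (measurableT_comp (@measurable_eps_rectangles _ _ _ _ _ _ eps i)).
    by apply: mp => //; exact: measurable_best_response.
  have ind A B : measurable A -> eps_rectangles eps B ->
      P (lam @^-1` A `&` B) = (P (lam @^-1` A) * P B)%E.
    by move=> mA [C mC ->]; exact: lam_eps_independent.
  have [mLc mEZ LE] := independent_fubini (@eps_rectangles_measurable _ _ _ _ _
      _ eps)
    (eps_rectanglesT eps) (@eps_rectanglesI _ _ _ _ _ _ eps) ind mE.
  have EE l : P [set w | E (l, w)] = (Lc gamma l)%:E by rewrite LcE -LcPE.
  have mLc' : measurable_fun setT (Lc gamma).
    by apply/measurable_EFinP; move: mLc; under eq_fun do rewrite EE.
  (* Fubini integrates under the law of [lam]; the density turns this into an integral against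
     [h]. *)
  split=> //; rewrite -(integral_lebesgue_density lam_density)//.
  under eq_integral do rewrite -EE.
  rewrite -LE /L /likelihood fineK//; exact: fin_num_measure.
have Mlc i : log_concave (Gam `*` [set: 'cV[R]_d]) (fun p => M p.1 i p.2).
  split=> [p _|t p q' t01 [Gp _] [Gq _] [Gpq _]]; first exact: M0.
  (* The events are sections of best-response sets at fixed parameter and common shock;
     [best_response_conv] places mixtures of two sections in the section at the mixed point. *)
  have := log_concave_density_prob (eps_density i) (q_log_concave i) t01
    (mBR p.1 i p.2) (mBR q'.1 i q'.2)
    (mBR ((1 - t) *: p + t *: q').1 i ((1 - t) *: p + t *: q').2).
  by apply; move=> a b; exact: best_response_conv.
have Lclc : log_concave (Gam `*` [set: 'cV[R]_d]) (fun p => Lc p.1 p.2).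
  apply: (eq_log_concave _ (log_concave_prod Mlc)) => p _.
  by rewrite LcE.
split=> //.
- by move=> gamma _; rewrite (LI gamma).2; under eq_integral do rewrite LcE.
split=> [g _|t g0 g1 t01 G0 G1 Gt]; first by rewrite fine_ge0.
have mLch gamma : measurable_fun setT (fun l => Lc gamma l * h l).
  by apply: measurable_funM => //; exact: (LI gamma).1.
apply: (prekopa_leindler_real t01 (mLch g0) (mLch g1) (mLch ((1 - t) *: g0 + t
    *: g1)) _ _ _ _
  (esym (LI _).2) (esym (LI _).2) (esym (LI _).2)); try by move=> l; rewrite
      mulr_ge0.
(* Regrouping the powers by factor leaves the joint log-concavity of [Lc] and that of [h]. *)
move=> l0 l1; rewrite !powRM// mulrACA ler_pM ?mulr_ge0 ?powR_ge0//.
  have [_ H] := Lclc.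
  exact: (H t (g0, l0) (g1, l1)).
by have [_ H] := h_log_concave; exact: H.
Qed.
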